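(* Let $G$ be a connected block graph with vertices $v_1,\dots,v_n$, such that $v_n$ (the root vertex) is not a cut vertex and lies in a maximal clique of $G$ containing only one cut vertex. Assume that the vertices are ordered so that, when each cut vertex is assigned to the block containing it that is closest to the root $v_n$, the vertices assigned to any given block (maximal clique) are consecutive in the ordering. Let $k$ be the number of blocks of $G$, listed in the order in which their assigned vertices appear in the ordering, and let $s_1,\dots,s_k$ be their numbers of vertices. Let $P=P(G)$ be the $n\times n$ matrix with $P_{i,j}=1$ if $v_i$ lies on the shortest path from $v_j$ to $v_n$, and $P_{i,j}=0$ otherwise. Then $$P\,L(G)\,P^{t}=\bigoplus_{i=1}^{k}B_{s_i}\oplus[0],$$ where $B_s=sI_{s-1}-J_{s-1}$ for $s\ge 3$, and $B_2=I_1=[1]$.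
   Context: A block graph (clique tree) is a graph in which every block (maximal subgraph that is connected and has no cut vertex of its own) is a clique; in a connected block graph, there is a unique shortest path between any two vertices, and paths include their endpoints. A vertex that is not a cut vertex lies in exactly one block and is assigned to it; for a cut vertex $w$, the block containing $w$ closest to the root $v_n$ is the one containing the first edge of the shortest path from $w$ to $v_n$. The Laplacian matrix is $L(G)=\deg(G)-A(G)$, with $A(G)$ the adjacency matrix and $\deg(G)$ the diagonal matrix of vertex degrees, rows and columns indexed in the order $v_1,\dots,v_n$. $I_m$ is the $m\times m$ identity matrix, $J_m$ the $m\times m$ all-ones matrix, $\oplus$ is the block-diagonal direct sum of matrices, and $P^t$ is the transpose of $P$. *)

(* Defs.v *)
From HB Require Import structures.
From mathcomp Require Import all_boot all_order all_algebra.
From mathcomp Require Import boolp.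

Set Implicit Arguments.
Unset Strict Implicit.
Unset Printing Implicit Defensive.

Import GRing.Theory.
Local Open Scope ring_scope.

(* Simple graphs whose vertices are drawn from an ambient finite type, so that
   a graph and its subgraphs live in the same type. *)
Record sgraph (T : finType) := SGraph {
  verts : {set T};
  adj : rel T;
  adj_sym : symmetric adj;
  adj_irrefl : irreflexive adj;
  adj_verts : forall x y, adj x y -> x \in verts }.

Definition subgraph (T : finType) (H G : sgraph T) : Prop :=
  verts H \subset verts G /\ subrel (adj H) (adj G).

(* Extensional equality: [adj] is a function and the record carries proofs. *)
Definition same_graph (T : finType) (H G : sgraph T) : Prop :=
  verts H = verts G /\ adj H =2 adj G.

Definition connected (T : finType) (G : sgraph T) : Prop :=
  verts G != set0 /\ {in verts G &, forall x y, connect (adj G) x y}.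

Definition del_rel (T : finType) (G : sgraph T) (x : T) : rel T :=
  fun y z => [&& y != x, z != x & adj G y z].

Lemma del_rel_sym (T : finType) (G : sgraph T) (x : T) :
  symmetric (del_rel G x).
Proof. by move=> y z; rewrite /del_rel adj_sym andbCA. Qed.

Lemma del_rel_irrefl (T : finType) (G : sgraph T) (x : T) :
  irreflexive (del_rel G x).
Proof. by move=> y; rewrite /del_rel adj_irrefl !andbF. Qed.

Lemma del_rel_verts (T : finType) (G : sgraph T) (x y z : T) :
  del_rel G x y z -> y \in verts G :\ x.
Proof. by case/and3P=> yx _ /adj_verts yG; rewrite in_setD1 yx. Qed.

Definition del_vertex (T : finType) (G : sgraph T) (x : T) : sgraph T :=
  SGraph (@del_rel_sym T G x) (@del_rel_irrefl T G x) (@del_rel_verts T G x).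

Definition components (T : finType) (G : sgraph T) : nat :=
  n_comp (adj G) (verts G).

Definition cut_vertex (T : finType) (G : sgraph T) (x : T) : bool :=
  (x \in verts G) && (components G < components (del_vertex G x))%N.

Definition nonseparable (T : finType) (G : sgraph T) : Prop :=
  connected G /\ forall x, ~~ cut_vertex G x.

Definition block (T : finType) (G B : sgraph T) : Prop :=
  [/\ subgraph B G, nonseparable B &
      forall H, subgraph H G -> nonseparable H -> subgraph B H -> subgraph H B].

Definition clique (T : finType) (G : sgraph T) (K : {set T}) : bool :=
  (K \subset verts G) &&
  [forall x in K, forall y in K, (x != y) ==> adj G x y].

Definition block_graph (T : finType) (G : sgraph T) : Prop :=
  forall B, block G B -> clique B (verts B).

Definition maximal_clique (T : finType) (G : sgraph T) (K : {set T}) : bool :=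
  maxset (clique G) K.

(* The path is [x :: p], so [size p] is its number of edges. *)
Definition shortest_path (T : finType) (G : sgraph T) (x y : T) (p : seq T) :
    Prop :=
  [/\ path (adj G) x p, last x p = y &
      forall q, path (adj G) x q -> last x q = y -> (size p <= size q)%N].

(* Intended for a block [B] of [G], where [r] is the root of [G]; for a cut
   vertex, the first edge of the shortest path to [r] must lie in [B]. *)
Definition assigned (T : finType) (G : sgraph T) (r : T) (B : sgraph T)
    (x : T) : Prop :=
  if cut_vertex G x then
    exists y p, shortest_path G x r (y :: p) /\ adj B x y
  else x \in verts B.

Definition degree (T : finType) (G : sgraph T) (x : T) : nat :=
  #|[set y | adj G x y]|.

Definition adjacency (R : comNzRingType) (n : nat) (G : sgraph 'I_n) :
    'M[R]_n :=
  \matrix_(i, j) (adj G i j)%:R.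

Definition laplacian (R : comNzRingType) (n : nat) (G : sgraph 'I_n) :
    'M[R]_n :=
  diag_mx (\row_i (degree G i)%:R) - adjacency R G.

Definition path_matrix (R : comNzRingType) (n : nat) (G : sgraph 'I_n)
    (r : 'I_n) : 'M[R]_n :=
  \matrix_(i, j) (`[< exists p, shortest_path G j r p /\ i \in j :: p >])%:R.

Definition Bmx (R : comNzRingType) (s : nat) : 'M[R]_(s.-1) :=
  if s == 2%N then 1%:M else (s%:R)%:M - const_mx 1.

(* Main.v *)
Require Import Defs.
From HB Require Import structures.
From mathcomp Require Import all_boot all_order all_algebra.
From mathcomp Require Import boolp.
From mathcomp Require Import zify.

Set Implicit Arguments.
Unset Strict Implicit.
Unset Printing Implicit Defensive.

Import GRing.Theory.
Local Open Scope ring_scope.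

(** Row [x] of [P] is the indicator of the set [D_x] of descendants of [x], the
vertices whose shortest path to the root passes through [x].  The Laplacian
being a sum over edges, the entry [(x, y)] of [P L P^t] is
[\sum (1_{D_y} u - 1_{D_y} v)] over the edges [u v] that leave [D_x], with [u]
in [D_x] ([path_laplacianE]).  So everything rests on knowing the edges that
leave [D_x].

Shortest paths are controlled by one fact about blocks: the vertices of a simple
cycle are pairwise adjacent ([cycle_clique]), because a cycle is nonseparable,
hence contained in a block, hence in a clique.  Sort the vertices by their distance to the root.
If two vertices of the same level are joined by a walk that stays above that
level, then they have the same lower neighbour, because otherwise two descending
steps would close a cycle with a chord between levels at distance two
([steps_down_above]).  Hence each vertex [x] other than the root has a unique
[parent], adjacent vertices of the same level have the same parent, and [x], its
neighbours of the same level and its parent form a clique [parent_clique x].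
This clique is a block, the one that [x] is assigned to, and the edges leaving
[D_x] are exactly those from [x] to the rest of it ([boundary_eq]).

Now read off the entries ([path_laplacian_entry]).  The root has no outgoing
boundary, so its row and its column vanish.  On the diagonal [x] has
[s - 1] boundary edges, [s] being the size of its block; if [y] shares the block
of [x], the only edge leaving both [D_x] and [D_y] is [x y], and it contributes
[-1]; vertices of distinct blocks have no boundary edge in common.  This is
[s I - J] on each block.

It remains to match indices.  Each block [B] is the parent clique of exactly
[#|B| - 1] vertices ([card_parent_clique_fibre]), and the ordering hypothesis
makes the map from vertices to block indices monotone.  A monotone map with
these fibre sizes is the block index of the block-diagonal sum
([monotone_sig1]). *)

(** * Nonseparable subgraphs and blocks *)

Section Nonseparable.
Local Open Scope nat_scope.
Variable T : finType.
Implicit Types (G H B : sgraph T) (S K : {set T}).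

Lemma connect_adj_sym G : connect_sym (adj G).
Proof. exact/sym_connect_sym/adj_sym. Qed.

Lemma n_comp_le1 (e : rel T) S :
  connect_sym e -> {in S &, forall x y, connect e x y} -> n_comp e S <= 1.
Proof.
move=> sym_e conS; apply/card_le1P => x /andP[/= /eqP rx xS].
move=> y; apply/idP/eqP => [/andP[/= /eqP ry yS]|->].
  by rewrite -rx -ry; apply/(fingraph.rootP sym_e)/conS.
by rewrite inE /= /roots rx eqxx.
Qed.

Lemma n_comp_gt0 (e : rel T) S x :
  connect_sym e -> closed e S -> x \in S -> 0 < n_comp e S.
Proof.
move=> sym_e clS xS; apply/card_gt0P; exists (fingraph.root e x).
apply/andP; split; first exact: roots_root.
by rewrite inE -(closed_connect clS (connect_root e x)).
Qed.

Lemma closed_verts G : closed (adj G) (verts G).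
Proof.
by move=> x y xy; rewrite (adj_verts xy) (@adj_verts _ G y x) // adj_sym.
Qed.

(** Counting components is traded for connectedness here: a connected graph has
at least one component, and a graph whose vertices are pairwise connected has at
most one, so a vertex whose deletion preserves connectedness is not a cut
vertex. *)
Lemma nonseparable_del G :
  verts G != set0 ->
  {in verts G &, forall x y, connect (adj G) x y} ->
  (forall x, {in verts G :\ x &, forall y z, connect (del_rel G x) y z}) ->
  nonseparable G.
Proof.
move=> V0 con delcon; split=> // x; rewrite negb_and -leqNgt.
apply/orP; right; apply: (@leq_trans 1).
  exact/n_comp_le1/delcon/sym_connect_sym/del_rel_sym.
have /set0Pn[y yV] := V0.
exact: n_comp_gt0 (@connect_adj_sym G) (@closed_verts G) yV.
Qed.

Definition induced_adj G S : rel T := fun x y => [&& x \in S, y \in S & adj G x y].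

Lemma induced_sym G S : symmetric (induced_adj G S).
Proof. by move=> x y; rewrite /induced_adj adj_sym andbCA. Qed.

Lemma induced_irrefl G S : irreflexive (induced_adj G S).
Proof. by move=> x; rewrite /induced_adj adj_irrefl !andbF. Qed.

Lemma induced_verts G S x y : induced_adj G S x y -> x \in S.
Proof. by case/and3P. Qed.

Definition induced G S : sgraph T :=
  SGraph (@induced_sym G S) (@induced_irrefl G S) (@induced_verts G S).

Lemma induced_subgraph G S : S \subset verts G -> subgraph (induced G S) G.
Proof. by move=> sSG; split=> // x y /and3P[]. Qed.

Lemma path_connect_in (e : rel T) x p :
  connect_sym e -> path e x p -> {in x :: p &, forall y z, connect e y z}.
Proof.
move=> sym_e xp y z /(path_connect xp) xy /(path_connect xp).
by apply: connect_trans; rewrite sym_e.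
Qed.

Lemma nonseparable_clique G K :
  clique G K -> K != set0 -> nonseparable (induced G K).
Proof.
case/andP=> KG /forall_inP adjK K0.
have adjP x y : x \in K -> y \in K -> x != y -> adj G x y.
  by move=> xK yK xy; move/forall_inP/(_ y yK)/implyP: (adjK x xK) => /(_ xy).
apply: nonseparable_del => //= [x y xK yK|x y z].
  have [->//|xy] := eqVneq x y; apply: connect1.
  by rewrite /= /induced_adj xK yK adjP.
rewrite !inE => /andP[yx yK] /andP[zx zK].
have [->//|yz] := eqVneq y z; apply: connect1.
by rewrite /del_rel /= /induced_adj yx zx yK zK adjP.
Qed.

(** Deleting a vertex of a cycle leaves a path, which is connected. *)
Lemma nonseparable_cycle G s :
  s != [::] -> ucycle (adj G) s -> nonseparable (induced G [set x in s]).
Proof.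
move=> s0 /andP[cs us].
have in_path (e : rel T) x p : path (adj G) x p ->
    {in x :: p &, forall y z, adj G y z -> e y z} -> path e x p.
  by move=> xp sub; apply: (sub_in_path (P := mem (x :: p))) xp => //; apply/allP.
apply: nonseparable_del => /=.
- by case: s s0 {cs us} => // x s _; apply/set0Pn; exists x; rewrite !inE eqxx.
- case: s cs {us} s0 => // x s + _; rewrite /cycle rcons_path => /andP[xs _] y z.
  rewrite !in_set; apply: path_connect_in.
    exact/sym_connect_sym/induced_sym.
  apply: in_path xs _ => a b ain bin ab.
  by rewrite /induced_adj !in_set ain bin.
move=> x y z; rewrite !inE => /andP[yx ys] /andP[zx zs].
have [w [p [wp sub xNwp ywp zwp]]] : exists w p, [/\ path (adj G) w p,
    {subset w :: p <= s}, x \notin w :: p, y \in w :: p & z \in w :: p].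
  (* Open the cycle at [x] if it passes through [x], anywhere otherwise. *)
  have [xs|xs] := boolP (x \in s); last first.
    case: s cs {us s0} ys zs xs => // w p; rewrite /cycle rcons_path => /andP[wp _].
    by exists w, p; split.
  have [i s' rs] := rot_to xs.
  have ms u : (u \in s) = (u \in x :: s') by rewrite -rs mem_rot.
  move: cs us; rewrite -(rot_cycle i) -(rot_uniq i) rs.
  move: ys zs; rewrite !ms !(in_cons x) (negPf yx) (negPf zx) /=.
  case: s' ms {rs} => // w p ms ys zs; rewrite /cycle /=.
  rewrite rcons_path => /and3P[_ wp _] /andP[xNwp _].
  by exists w, p; split=> // u uwp; rewrite ms inE uwp orbT.
apply: path_connect_in ywp zwp.
  exact/sym_connect_sym/del_rel_sym.
apply: in_path wp _ => a b ain bin ab.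
rewrite /del_rel /= /induced_adj !in_set ab !sub // !andbT.
by apply/andP; split; [move: ain | move: bin]; apply: contraTneq => ->.
Qed.

Definition edges G : {set T * T} := [set e | adj G e.1 e.2].

(** A measure of subgraphs that must see the edges as well as the vertices, since
a proper subgraph may have all the vertices. *)
Lemma subgraph_card_lt H H' :
  subgraph H H' -> ~ subgraph H' H ->
  #|verts H| + #|edges H| < #|verts H'| + #|edges H'|.
Proof.
move=> [sV sE] nsub.
have sE' : edges H \subset edges H'.
  by apply/subsetP => e; rewrite !inE; apply: sE.
rewrite ltn_neqAle leq_add ?subset_leq_card // andbT; apply/eqP => eqc.
apply: nsub; have := subset_leqif_cards sV; have := subset_leqif_cards sE'.
move=> [leE eE] [leV eV].
have /eqP/esym : #|verts H| == #|verts H'| by lia.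
have /eqP/esym : #|edges H| == #|edges H'| by lia.
move/esym/eqP; rewrite eE => /eqP EE /esym/eqP; rewrite eV => /eqP VV.
split; first by rewrite VV.
by move=> x y xy; have := in_set (fun e => adj H e.1 e.2) (x, y);
   rewrite -/(edges H) EE inE /= xy.
Qed.

(** As long as a nonseparable subgraph is not a block it has a strictly larger
nonseparable extension, and sizes are bounded. *)
Lemma nonseparable_sub_block G H :
  subgraph H G -> nonseparable H -> exists2 B, block G B & subgraph H B.
Proof.
have [n] := ubnP (#|T| + #|{: T * T}| - (#|verts H| + #|edges H|)).
elim: n H => // n IHn H leHn sHG nsH.
have [bH|nbH] := pselect (block G H); first by exists H => //; split.
have [H' [sH'G nsH' sHH' nsub]] :
    exists H', [/\ subgraph H' G, nonseparable H', subgraph H H' & ~ subgraph H' H].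
  apply: contrapT => no; apply: nbH; split=> // H' ? ? ?.
  by apply: contrapT => ?; apply: no; exists H'.
have lt := subgraph_card_lt sHH' nsub.
have leV : #|verts H'| <= #|T| := max_card _.
have leE : #|edges H'| <= #|{: T * T}| := max_card _.
have leH'n : #|T| + #|{: T * T}| - (#|verts H'| + #|edges H'|) < n by lia.
have [B bB sH'B] := IHn H' leH'n sH'G nsH'.
exists B => //; have [a b] := sHH'; have [c d] := sH'B; split.
  exact: subset_trans a c.
by move=> x y /b/d.
Qed.

Lemma clique_adj G K x y :
  clique G K -> x \in K -> y \in K -> x != y -> adj G x y.
Proof.
move=> /andP[_ /forall_inP/(_ x) h] xK yK xy.
by have /forall_inP/(_ y yK)/implyP := h xK; apply.
Qed.

(** In a block graph a block is determined by its vertex set: [clique B] speaks of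
the adjacency of the block itself. *)
Lemma block_adj G B : block_graph G -> block G B ->
  {in verts B &, forall x y, x != y -> adj B x y}.
Proof. by move=> bg /bg clB x y; apply: clique_adj. Qed.

Lemma block_clique G B : block_graph G -> block G B -> clique G (verts B).
Proof.
move=> bg bB; have [[sV sE] _ _] := bB; rewrite /clique sV.
apply/forall_inP => x xB; apply/forall_inP => y yB; apply/implyP => xy.
exact/sE/(block_adj bg bB).
Qed.

Lemma nonseparable_in_block G S : S \subset verts G ->
  nonseparable (induced G S) -> exists2 B, block G B & S \subset verts B.
Proof.
move=> /induced_subgraph sSG /(nonseparable_sub_block sSG)[B bB [sSB _]].
by exists B.
Qed.

Lemma clique_in_block G K :
  clique G K -> K != set0 -> exists2 B, block G B & K \subset verts B.
Proof.
move=> clK K0; apply: nonseparable_in_block; first by case/andP: clK.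
exact: nonseparable_clique.
Qed.

(** All that the levels and parents below use of the block structure. *)
Lemma cycle_clique G s x y : block_graph G -> ucycle (adj G) s ->
  x \in s -> y \in s -> x != y -> adj G x y.
Proof.
move=> bg cs xs ys xy.
have s0 : s != [::] by case: s xs {cs ys}.
have sG : [set x in s] \subset verts G.
  apply/subsetP => z; rewrite in_set => zs.
  by case/andP: cs => /(next_cycle)/(_ zs)/adj_verts.
have [B bB /subsetP sB] := nonseparable_in_block sG (nonseparable_cycle s0 cs).
by apply: (clique_adj (block_clique bg bB)) => //; apply: sB; rewrite in_set.
Qed.

Lemma block_maximal G B K : block_graph G -> block G B -> clique G K ->
  verts B \subset K -> verts B = K.
Proof.
move=> bg bB clK sBK; have [[_ sE] [[B0 _] _] maxB] := bB.
have K0 : K != set0.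
  by have /set0Pn[x xB] := B0; apply/set0Pn; exists x; apply: (subsetP sBK).
have sBind : subgraph B (induced G K).
  split=> // x y xy; rewrite /= /induced_adj sE // !(subsetP sBK) //.
    by apply: (@adj_verts _ B y x); rewrite adj_sym.
  exact: adj_verts xy.
have sKG : K \subset verts G by case/andP: clK.
have [sKB _] := maxB _ (induced_subgraph sKG) (nonseparable_clique clK K0) sBind.
by apply/eqP; rewrite eqEsubset sBK.
Qed.

Lemma block_same_graph G B B' : block_graph G -> block G B -> block G B' ->
  verts B = verts B' -> same_graph B B'.
Proof.
move=> bg bB bB' eqV; split=> // x y; apply/idP/idP => xy.
  apply: (block_adj bg bB'); rewrite -?eqV ?(adj_verts xy) //.
    by rewrite (@adj_verts _ B y x) // adj_sym.
  by apply: contraTneq xy => ->; rewrite adj_irrefl.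
apply: (block_adj bg bB); rewrite ?eqV ?(adj_verts xy) //.
  by rewrite (@adj_verts _ B' y x) // adj_sym.
by apply: contraTneq xy => ->; rewrite adj_irrefl.
Qed.

End Nonseparable.

(** * Levels, parents and parent cliques *)
Section Rooted.
Local Open Scope nat_scope.
Variables (T : finType) (G : sgraph T) (r : T).
Hypothesis bg : block_graph G.
Hypothesis spanning : verts G = [set: T].
Hypothesis to_root : forall x, connect (adj G) x r.
Implicit Types (x y z u v : T) (p q : seq T).

Lemma walk_to_root x :
  exists n, [exists p : n.-tuple T, path (adj G) x p && (last x p == r)].
Proof.
have /connectP[p xp lp] := to_root x.
by exists (size p); apply/existsP; exists (in_tuple p); rewrite xp -lp eqxx.
Qed.

Definition dist x : nat := ex_minn (walk_to_root x).

Lemma dist_le x p : path (adj G) x p -> last x p = r -> dist x <= size p.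
Proof.
move=> xp lp; rewrite /dist; case: ex_minnP => n _; apply.
by apply/existsP; exists (in_tuple p); rewrite xp lp eqxx.
Qed.

Lemma dist_path x :
  exists p, [/\ path (adj G) x p, last x p = r & size p = dist x].
Proof.
rewrite /dist; case: ex_minnP => n /existsP[p /andP[xp /eqP lp]] _.
by exists p; rewrite size_tuple.
Qed.

Lemma shortest_pathP x p : shortest_path G x r p <->
  [/\ path (adj G) x p, last x p = r & size p = dist x].
Proof.
split=> [[xp lp minp]|[xp lp sp]]; split=> //; last first.
  by move=> q xq lq; rewrite sp dist_le.
have [q [xq lq sq]] := dist_path x.
by apply/eqP; rewrite eqn_leq dist_le // andbT -sq minp.
Qed.

Lemma dist_root : dist r = 0.
Proof. by apply/eqP; rewrite -leqn0 (@dist_le r [::]). Qed.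

Lemma dist0_root x : dist x = 0 -> x = r.
Proof. by have [p [_ <- <-]] := dist_path x => /size0nil->. Qed.

Lemma dist_adj x y : adj G x y -> dist x <= (dist y).+1.
Proof.
move=> xy; have [p [yp lp <-]] := dist_path y.
by apply: (@dist_le x (y :: p)) => //=; rewrite xy.
Qed.

Definition steps_down x y := adj G x y && (dist x == (dist y).+1).

Lemma steps_downP x : x != r -> exists y, steps_down x y.
Proof.
move=> xr; have [[|y p] [/= xp lp sp]] := dist_path x.
  by rewrite lp eqxx in xr.
exists y; have /andP[xy yp] := xp; rewrite /steps_down xy /= eqn_leq dist_adj //.
by rewrite -sp ltnS dist_le.
Qed.

(** Induction on the level of [x] and [y].  Lower neighbours [x'] and [y'] of [x]
and [y] are themselves joined by a walk above their level, namely through [x] and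
[y], so by induction they share a lower neighbour [w].  Were [x'] and [y']
distinct, [w x' x ... y y'] would be a simple cycle and [x] would be adjacent to
[w], two levels below.  The case [x = y] is allowed and gives the uniqueness of
lower neighbours. *)
Lemma steps_down_above x y p : path (adj G) x p -> last x p = y ->
  dist x = dist y -> {in p, forall u, u = y \/ dist x < dist u} ->
  forall x' y', steps_down x x' -> steps_down y y' -> x' = y'.
Proof.
have [e] := ubnP (dist x); elim: e x y p => // e IHe x y p lte xp lp dxy above.
move=> x' y' /andP[xx' /eqP dx] /andP[yy' /eqP dy].
apply: contrapT => /eqP ne.
have dx'y' : dist x' = dist y' by lia.
have same w w' : steps_down x' w -> steps_down y' w' -> w = w'.
  apply: (IHe x' y' (x :: rcons p y')) => //=.
  - by lia.
  - by rewrite adj_sym xx' rcons_path xp lp.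
  - by rewrite last_rcons.
  move=> u; rewrite inE mem_rcons inE => /or3P[/eqP->|/eqP->|up].
  - by right; lia.
  - by left.
  by right; case: (above u up) => [->|]; lia.
have x'r : x' != r.
  apply: contraNneq ne => x'r; apply/eqP; rewrite x'r; apply/esym/dist0_root.
  by rewrite -dx'y' x'r dist_root.
have y'r : y' != r.
  apply: contraNneq ne => y'r; apply/eqP; rewrite y'r; apply/dist0_root.
  by rewrite dx'y' y'r dist_root.
have [w xw] := steps_downP x'r; have [w' yw'] := steps_downP y'r.
have eww := same _ _ xw yw'; rewrite -{}eww in yw'.
move: xw yw' => /andP[x'w /eqP dw] /andP[y'w _].
case/shortenP: xp lp => p' xp' up' sub lp.
suff /dist_adj : adj G x w by lia.
apply: (@cycle_clique _ G [:: w, x', x & rcons p' y']) => //.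
- apply/andP; split.
    rewrite /cycle /= !rcons_path xp' last_rcons lp yy' y'w.
    by rewrite adj_sym x'w adj_sym xx'.
  have dp u : u \in x :: p' -> dist x <= dist u.
    rewrite inE => /orP[/eqP->//|/sub/above[->|/ltnW//]].
    by rewrite dxy.
  have far v : dist v < dist x -> v \notin x :: p'.
    by move=> dv; apply/negP => /dp; rewrite leqNgt dv.
  rewrite -rcons_cons 2!cons_uniq rcons_uniq up' (in_cons x') !mem_rcons !(in_cons y').
  rewrite !(negPf (far _ _)) ?orbF ?negb_or; try lia.
  rewrite andbT ne andbT; apply/andP; split; apply/eqP => e'; rewrite e' in dw; lia.
- by rewrite !inE eqxx !orbT.
- by rewrite inE eqxx.
by apply: contra_eq_neq dw => <-; lia.
Qed.

Lemma steps_down_uniq x y z : steps_down x y -> steps_down x z -> y = z.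
Proof. exact: (@steps_down_above x x [::]). Qed.

(** Meaningful away from the root only: the root is its own parent by default. *)
Definition parent x := odflt x [pick y | steps_down x y].

Lemma parentP x : x != r -> steps_down x (parent x).
Proof.
move=> /steps_downP[y xy]; rewrite /parent.
by case: pickP => // /(_ y); rewrite xy.
Qed.

Lemma steps_down_root x y : steps_down x y -> x != r.
Proof. by move=> /andP[_ /eqP dx]; apply/eqP => xr; rewrite xr dist_root in dx. Qed.

Lemma parent_eq x y : steps_down x y -> parent x = y.
Proof.
by move=> xy; exact: steps_down_uniq (parentP (steps_down_root xy)) xy.
Qed.

Lemma dist_parent x : x != r -> dist x = (dist (parent x)).+1.
Proof. by case/parentP/andP=> _ /eqP. Qed.

Lemma adj_parent x : x != r -> adj G x (parent x).
Proof. by case/parentP/andP. Qed.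

Lemma parent_neq x : x != r -> parent x != x.
Proof. by move=> /dist_parent dx; apply/eqP => px; rewrite px in dx; lia. Qed.

Variant edge_spec x y : Prop :=
| EdgeDown of x != r & y = parent x
| EdgeUp of y != r & x = parent y
| EdgeLevel of dist x = dist y & x != r & y != r & parent x = parent y.

Lemma level_root x y : dist x = dist y -> x = r -> x = y.
Proof. by move=> dxy xr; rewrite xr (@dist0_root y) // -dxy xr dist_root. Qed.

Lemma edgeP x y : adj G x y -> edge_spec x y.
Proof.
move=> xy; have yx : adj G y x by rewrite adj_sym.
have xney : x != y by apply: contraTneq xy => ->; rewrite adj_irrefl.
have := dist_adj xy; rewrite leq_eqVlt => /orP[dx|dx].
  have s : steps_down x y by rewrite /steps_down xy.
  by apply: EdgeDown; [exact: steps_down_root s | rewrite (parent_eq s)].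
have := dist_adj yx; rewrite leq_eqVlt => /orP[dy|dy].
  have s : steps_down y x by rewrite /steps_down yx.
  by apply: EdgeUp; [exact: steps_down_root s | rewrite (parent_eq s)].
have dxy : dist x = dist y by lia.
have xr : x != r by apply/eqP => /(level_root dxy)/eqP; apply/negP.
have yr : y != r.
  by apply/eqP => /(level_root (esym dxy))/esym/eqP; apply/negP.
apply: EdgeLevel => //.
apply: (@steps_down_above x y [:: y]); rewrite /= ?xy //; try exact: parentP.
by move=> u; rewrite inE => /eqP->; left.
Qed.

(** For [x] other than the root, the vertices assigned to the same block as [x]. *)
Definition siblings x := [set y | (y == x) || (adj G x y && (dist x == dist y))].
Definition parent_clique x := parent x |: siblings x.

Lemma siblings_parent x y : x != r -> y \in siblings x ->
  [/\ y != r, parent y = parent x & dist y = dist x].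
Proof.
move=> xr; rewrite inE => /orP[/eqP->//|/andP[xy /eqP dxy]].
have yr : y != r.
  by apply: contraNneq xr => yr; rewrite -(level_root (esym dxy) yr) yr.
case: (edgeP xy) => [_ ey|_ ex|//]; first by have := dist_parent xr; rewrite -ey; lia.
by have := dist_parent yr; rewrite -ex; lia.
Qed.

(** The common parent of [y], [x] and [z] closes the path [y x z] into a cycle. *)
Lemma siblings_adj x y z : x != r ->
  y \in siblings x -> z \in siblings x -> y != z -> adj G y z.
Proof.
move=> xr ys zs yz.
have [yr py _] := siblings_parent xr ys; have [zr pz _] := siblings_parent xr zs.
move: ys zs; rewrite !inE.
have [yx _|yx /= /andP[xy /eqP dxy]] := eqVneq y x.
  by rewrite eq_sym -yx (negPf yz) /= => /andP[].
have [-> _|zx /= /andP[xz /eqP dxz]] := eqVneq z x; first by rewrite adj_sym.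
have ay := adj_parent yr; have az := adj_parent zr.
apply: (@cycle_clique _ G [:: parent x; y; x; z]) => //; last first.
- by rewrite !inE eqxx !orbT.
- by rewrite !inE eqxx !orbT.
apply/andP; split.
  by rewrite /cycle /= xz -{2}pz az (adj_sym G y x) xy (adj_sym G) -py ay.
have dx := dist_parent xr.
rewrite /= !inE (eq_sym x z) (negPf zx) (negPf yx) (negPf yz) /= andbT.
rewrite -{1}py (negPf (parent_neq yr)) (negPf (parent_neq xr)).
by rewrite -pz (negPf (parent_neq zr)).
Qed.

Lemma parent_adj_siblings x y : x != r -> y \in siblings x -> adj G (parent x) y.
Proof.
by move=> xr /(siblings_parent xr)[yr <- _]; rewrite adj_sym adj_parent.
Qed.

Lemma siblings_refl x : x \in siblings x. Proof. by rewrite inE eqxx. Qed.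

Lemma parentNsiblings x : x != r -> parent x \notin siblings x.
Proof.
by move=> xr; apply/negP => /(siblings_parent xr)[_ _]; rewrite (dist_parent xr); lia.
Qed.

Lemma parent_clique_clique x : x != r -> clique G (parent_clique x).
Proof.
move=> xr; rewrite /clique spanning subsetT /=.
apply/forall_inP => y yK; apply/forall_inP => z zK; apply/implyP.
move: yK zK; rewrite !(in_setU1 _ (parent x)).
case/predU1P=> [->|ys] /predU1P[->|zs]; rewrite ?eqxx //.
- by rewrite parent_adj_siblings.
- by rewrite adj_sym parent_adj_siblings.
exact: siblings_adj ys zs.
Qed.

(** A vertex [y] adjacent to both [x] and [parent x] cannot lie above [x], two
levels away from [parent x], and the only one below [x] is [parent x]. *)
Lemma clique_parent_clique K x : clique G K -> x != r ->
  x \in K -> parent x \in K -> K \subset parent_clique x.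
Proof.
move=> clK xr xK pK; apply/subsetP => y yK; rewrite in_setU1.
have [//|yp] := eqVneq y (parent x); have [->|yx] := eqVneq y x.
  by rewrite siblings_refl.
have xy : adj G x y by rewrite (clique_adj clK) // eq_sym.
rewrite inE xy; case: (edgeP xy) => [_ ey|yr ex|->]; last by rewrite eqxx !orbT.
  by rewrite ey eqxx in yp.
have := dist_adj (clique_adj clK yK pK yp).
by rewrite (dist_parent yr) -ex (dist_parent xr); lia.
Qed.

Lemma block_parent_clique B x : block G B -> x != r ->
  x \in verts B -> parent x \in verts B -> verts B = parent_clique x.
Proof.
move=> bB xr xB pB; apply: block_maximal (parent_clique_clique xr) _ => //.
exact: clique_parent_clique (block_clique bg bB) xr xB pB.
Qed.

Lemma parent_clique_block x : x != r ->
  exists2 B, block G B & verts B = parent_clique x.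
Proof.
move=> xr; have xK : x \in parent_clique x by rewrite in_setU1 siblings_refl orbT.
have [|B bB sKB] := clique_in_block (parent_clique_clique xr).
  by apply/set0Pn; exists x.
exists B => //; apply: block_parent_clique => //; apply: (subsetP sKB) => //.
by rewrite in_setU1 eqxx.
Qed.

Lemma siblings_eq x y : x != r -> y \in siblings x -> siblings y = siblings x.
Proof.
move=> xr ys; have [yr py dy] := siblings_parent xr ys.
apply/setP => z; apply/idP/idP => zs.
  have [->|zx] := eqVneq z x; first exact: siblings_refl.
  have [zr _ dz] := siblings_parent yr zs.
  have xsy : x \in siblings y.
    move: ys; rewrite !inE eq_sym adj_sym eq_sym [dist x == _]eq_sym.
    by rewrite eq_sym.
  by rewrite inE (siblings_adj yr xsy zs) 1?eq_sym // dz dy eqxx orbT.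
have [_ _ dz] := siblings_parent xr zs.
have [->|zy] := eqVneq z y; first exact: siblings_refl.
by rewrite inE (siblings_adj xr ys zs) 1?eq_sym // dz dy eqxx orbT.
Qed.

Lemma parent_clique_eq x y : x != r -> y != r ->
  (parent_clique y == parent_clique x) = (y \in siblings x).
Proof.
move=> xr yr; apply/eqP/idP => [eK|ys]; last first.
  by rewrite /parent_clique (siblings_eq xr ys); have [_ -> _] := siblings_parent xr ys.
have : y \in parent_clique x by rewrite -eK in_setU1 siblings_refl orbT.
rewrite in_setU1 => /predU1P[ey|//].
have : parent y \in parent_clique x by rewrite -eK in_setU1 eqxx.
rewrite in_setU1 => /predU1P[pyx|/(siblings_parent xr)[_ _]].
  by have := dist_parent yr; rewrite pyx ey; lia.
by have := dist_parent yr; have := dist_parent xr; rewrite ey; lia.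
Qed.

(** If some [x] has its parent in [B], then [B] is the parent clique of [x], and of
its siblings only.  Otherwise [B] lies in a single level; unless it consists of
the root, it could be enlarged by a parent, against maximality.  So the second
case is the one-vertex graph, where both sides vanish. *)
Lemma card_parent_clique_fibre B : block G B ->
  #|[set x | (x != r) && (verts B == parent_clique x)]| = #|verts B|.-1.
Proof.
move=> bB; have clB := block_clique bg bB.
have [[x /and3P[xr xB pB]]|no] :=
    pselect (exists x, [&& x != r, x \in verts B & parent x \in verts B]).
  have VB := block_parent_clique bB xr xB pB.
  rewrite VB cardsU1 parentNsiblings //=; apply: eq_card => y.
  rewrite !in_set; have [->|yr] /= := eqVneq y r.
    apply/esym/negbTE/negP => rs; have [] := siblings_parent xr (y := r) _.
      by rewrite inE.
    by rewrite eqxx.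
  by rewrite eq_sym parent_clique_eq // inE.
have -> : [set x | (x != r) && (verts B == parent_clique x)] = set0.
  apply/setP => x; rewrite !inE; apply/negP => /andP[xr /eqP VB].
  by apply: no; exists x; rewrite xr VB !in_setU1 eqxx siblings_refl orbT.
have [_ [[/set0Pn[x xB] _] _] _] := bB.
have sub y : y != r -> y \in verts B -> verts B \subset siblings y.
  move=> yr yB; apply/subsetP => z zB; rewrite inE.
  have [//|zy] := eqVneq z y.
  have yz : adj G y z by rewrite (clique_adj clB) // eq_sym.
  rewrite yz; case: (edgeP yz) => [_ ez|zr ey|-> _ _ _]; last by rewrite eqxx orbT.
    by case: no; exists y; rewrite yr yB -ez.
  by case: no; exists z; rewrite zr zB -ey.
have Br y : y \in verts B -> y = r.
  move=> yB; apply: contrapT => /eqP yr.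
  have VB : verts B = parent_clique y.
    apply: block_maximal (parent_clique_clique yr) _ => //.
    exact: subset_trans (sub y yr yB) (subsetUr _ _).
  by case: no; exists y; rewrite yr yB VB in_setU1 eqxx.
suff -> : verts B = [set r] by rewrite cards1 cards0.
apply/setP => y; rewrite inE; apply/idP/eqP => [/Br//|->].
by rewrite -(Br x xB).
Qed.

(** For a cut vertex the first step of a shortest path to the root is the step to
the parent, which stays in the parent clique. *)
Lemma assigned_parent_clique B x : block G B -> x != r ->
  verts B = parent_clique x -> assigned G r B x.
Proof.
move=> bB xr VB; have xB : x \in verts B by rewrite VB in_setU1 siblings_refl orbT.
rewrite /assigned; case: ifP => // _.
have [p [pp lp sp]] := dist_path (parent x).
exists (parent x), p; split; last first.
  apply: (block_adj bg bB) => //; last by rewrite eq_sym parent_neq.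
  by rewrite VB in_setU1 eqxx.
by apply/shortest_pathP; rewrite /= adj_parent // pp lp sp -dist_parent.
Qed.

End Rooted.

(** * Descendants and the edges that leave them *)
Section Descendants.
Local Open Scope nat_scope.
Variables (T : finType) (G : sgraph T) (r : T).
Hypothesis bg : block_graph G.
Hypothesis spanning : verts G = [set: T].
Hypothesis to_root : forall x, connect (adj G) x r.
Local Notation dist := (dist to_root).
Local Notation parent := (parent to_root).
Local Notation siblings := (siblings to_root).
Local Notation parent_clique := (parent_clique to_root).

(** The same formula as in [path_matrix], so that the entries of that matrix are
indicators of [desc] by conversion. *)
Definition desc x u : bool := `[< exists p, shortest_path G u r p /\ x \in u :: p >].

Lemma desc_self x : desc x x.
Proof.
apply/asboolP; have [p hp] := dist_path to_root x.
by exists p; split; [apply/(shortest_pathP to_root)|rewrite mem_head].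
Qed.

Lemma desc_of_root u : desc r u.
Proof.
apply/asboolP; have [p hp] := dist_path to_root u.
exists p; split; first exact/(shortest_pathP to_root).
by have [_ lp _] := hp; have := mem_last u p; rewrite lp.
Qed.

Lemma desc_root x : desc x r = (x == r).
Proof.
apply/idP/eqP => [/asboolP[p [/(shortest_pathP to_root)[_ _]]]|->]; last first.
  exact: desc_self.
by rewrite (dist_root to_root) => /size0nil->; rewrite inE => /eqP.
Qed.

Lemma desc_parent x u : u != r -> desc x u = (x == u) || desc x (parent u).
Proof.
move=> ur; apply/idP/predU1P => [/asboolP[p [/(shortest_pathP to_root)[up lp sp]]]|].
  rewrite inE => /predU1P[->|xp]; [by left|right].
  case: p up lp sp xp => // y p /= /andP[uy yp] lp sp xp.
  have dy : dist u = (dist y).+1.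
    apply/eqP; rewrite eqn_leq (dist_adj to_root uy) /= -sp ltnS.
    exact: (dist_le to_root yp).
  have -> : parent u = y by apply: (parent_eq bg); rewrite /steps_down uy dy eqxx.
  apply/asboolP; exists p; split => //; apply/(shortest_pathP to_root).
  by split=> //; apply/eq_add_S; rewrite -dy.
case=> [->|/asboolP[p [/(shortest_pathP to_root)[up lp sp]] xp]].
  exact: desc_self.
apply/asboolP; exists (parent u :: p); split; last by rewrite inE xp orbT.
apply/(shortest_pathP to_root).
by rewrite /= (adj_parent to_root ur) up lp sp -dist_parent.
Qed.

Lemma desc_dist x u : desc x u -> u = x \/ dist x < dist u.
Proof.
have [n] := ubnP (dist u); elim: n u => // n IHn u lt.
have [->|ur] := eqVneq u r; first by rewrite desc_root => /eqP->; left.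
rewrite desc_parent // => /predU1P[->|]; first by left.
have du := dist_parent to_root ur.
move/IHn => [|<-|]; first by lia.
  by right; lia.
by right; lia.
Qed.

(** The edge cannot lead away from the root, as [v] would descend from [u]; and
if [u] were not [x], then [parent u] would be in [D_x], while it is either [v] or
the parent of [v]. *)
Lemma desc_boundary x u v : adj G u v -> desc x u -> ~~ desc x v ->
  [/\ x != r, u = x & v \in parent_clique x].
Proof.
move=> uv du dv.
have xr : x != r by apply: contraNneq dv => ->; rewrite desc_of_root.
suff ux : u = x.
  split=> //; rewrite in_setU1; case: (edgeP bg to_root uv) => [ur ->|vr eu|dd _ _ _].
  - by rewrite ux eqxx.
  - by move: dv; rewrite desc_parent // -eu du orbT.
  by rewrite inE -ux uv dd eqxx !orbT.
case: (edgeP bg to_root uv) => [ur ev|vr eu|dd ur vr pp].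
- by move: du; rewrite desc_parent // -ev (negPf dv) orbF => /eqP.
- by move: dv; rewrite desc_parent // -eu du orbT.
move: du dv; rewrite (desc_parent x ur) (desc_parent x vr) pp => /predU1P[//|->].
by rewrite orbT.
Qed.

Lemma parent_clique_adj x v : x != r -> v \in parent_clique x -> v != x -> adj G x v.
Proof.
move=> xr vK vx; rewrite (clique_adj (parent_clique_clique bg spanning to_root xr)) //.
  by rewrite in_setU1 siblings_refl orbT.
by rewrite eq_sym.
Qed.

Lemma parent_cliqueNdesc x v : x != r -> v \in parent_clique x -> v != x -> ~~ desc x v.
Proof.
move=> xr vK vx; apply/negP => /desc_dist[/eqP|]; first exact/negP.
move: vK; rewrite in_setU1 => /predU1P[->|/(siblings_parent bg xr)[_ _ ->]].
  by rewrite (dist_parent to_root xr); lia.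
by rewrite ltnn.
Qed.

Lemma boundary_eq x u v : x != r -> desc x u ->
  adj G u v && ~~ desc x v = (u == x) && (v \in parent_clique x :\ x).
Proof.
move=> xr du; apply/andP/andP => [[uv dv]|[/eqP->]].
  have [_ -> vK] := desc_boundary uv du dv; rewrite eqxx in_setD1 vK andbT.
  by split=> //; apply: contraNneq dv => ->; apply: desc_self.
rewrite in_setD1 => /andP[vx vK].
by rewrite parent_clique_adj // parent_cliqueNdesc.
Qed.

End Descendants.

(** Edges inside [A] cancel in pairs: each one occurs in both directions, with
opposite contributions.  The cancellation is an exchange of summations, so that
it is valid in characteristic two as well. *)
Lemma cut_sum (R : zmodType) (I : finType) (e : rel I) (A : pred I) (b : I -> R) :
  symmetric e ->
  \sum_(u | A u) \sum_(v | e u v) (b u - b v) =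
  \sum_(u | A u) \sum_(v | e u v && ~~ A v) (b u - b v).
Proof.
move=> sym_e.
under eq_bigr => u _ do rewrite (bigID A).
rewrite big_split /= -[RHS]add0r; congr (_ + _).
under eq_bigr => u _ do rewrite sumrB.
rewrite sumrB; apply/eqP; rewrite subr_eq0; apply/eqP.
rewrite (exchange_big_dep A) /=; last by move=> u v _ /andP[].
by apply: eq_bigr => u Au; apply: eq_bigl => v; rewrite sym_e Au andbT andbC.
Qed.

(** * The entries of the transformed Laplacian *)
Section Entries.
Variables (R : comNzRingType) (n : nat) (G : sgraph 'I_n) (r : 'I_n).
Hypothesis bg : block_graph G.
Hypothesis spanning : verts G = [set: 'I_n].
Hypothesis to_root : forall x, connect (adj G) x r.
Local Notation parent_clique := (parent_clique to_root).
Local Notation P := (path_matrix R G r).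
Local Notation M := (P *m laplacian R G *m P^T).

Lemma laplacian_mul (A : 'M[R]_n) u y :
  (laplacian R G *m A) u y = \sum_(v | adj G u v) (A u y - A v y).
Proof.
rewrite mulmxBl mxE sumrB mul_diag_mx !mxE; congr (_ - _).
  by rewrite sumr_const mulr_natl /degree cardsE.
rewrite [RHS]big_mkcond /=; apply: eq_bigr => v _; rewrite mxE.
by case: ifP; rewrite ?mul1r ?mul0r.
Qed.

Lemma path_laplacianE x y : M x y =
  \sum_(u | desc G r x u) \sum_(v | adj G u v && ~~ desc G r x v)
    ((desc G r y u)%:R - (desc G r y v)%:R).
Proof.
rewrite -(cut_sum _ _ (@adj_sym _ G)) -mulmxA mxE [RHS]big_mkcond.
apply: eq_bigr => u _; rewrite laplacian_mul !mxE -/(desc G r x u).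
case: ifP => _; rewrite ?mul0r // mul1r.
by apply: eq_bigr => v _; rewrite !mxE.
Qed.

Lemma path_laplacian_rootl y : M r y = 0.
Proof.
rewrite path_laplacianE big1 // => u _; rewrite big1 // => v.
by rewrite (desc_of_root to_root) andbF.
Qed.

Lemma path_laplacian_rootr x : M x r = 0.
Proof.
rewrite path_laplacianE big1 // => u _; rewrite big1 // => v _.
by rewrite !(desc_of_root to_root) subrr.
Qed.

Lemma path_laplacian_parent_clique x y : x != r -> M x y =
  \sum_(v in parent_clique x :\ x) ((desc G r y x)%:R - (desc G r y v)%:R).
Proof.
move=> xr; rewrite path_laplacianE (bigD1 x) ?(desc_self to_root) //=.
rewrite [X in _ + X]big1 ?addr0 => [|u /andP[du ux]].
  apply: eq_bigl => v.
  by rewrite (boundary_eq bg spanning to_root) ?eqxx ?(desc_self to_root).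
by apply: big_pred0 => v; rewrite (boundary_eq bg spanning to_root) // (negPf ux).
Qed.

Lemma path_laplacian_entry x y : x != r -> y != r -> M x y =
  (#|parent_clique x|)%:R *+ (x == y) - (parent_clique y == parent_clique x)%:R.
Proof.
move=> xr yr; rewrite path_laplacian_parent_clique //.
have xK : x \in parent_clique x by rewrite in_setU1 siblings_refl orbT.
have [<-|xy] := eqVneq x y.
  rewrite (desc_self to_root) eqxx (cardsD1 x) xK mulr1n natrD addrAC subrr add0r.
  rewrite -sumr_const; apply: eq_bigr => v; rewrite in_setD1 => /andP[vx vK].
  by rewrite (negPf (parent_cliqueNdesc bg _ vK vx)) ?subr0.
rewrite mulr0n sub0r parent_clique_eq //.
(* The edge from [x] to [v] contributes only if it leaves [D_y] as well; as [y]
   is not [x], this forces [v = y] and makes [x] and [y] siblings. *)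
have other v : v \in parent_clique x :\ x ->
    (desc G r y x)%:R - (desc G r y v)%:R =
    - ((v == y) && (y \in siblings to_root x))%:R :> R.
  rewrite in_setD1 => /andP[vx vK].
  have xv := parent_clique_adj bg spanning xr vK vx.
  have [dx|dx] := boolP (desc G r y x); have [dv|dv] := boolP (desc G r y v).
  - rewrite subrr. have [evy|] := eqVneq v y; last by rewrite oppr0.
    rewrite evy in vK vx *.
    have [ys|] := boolP (y \in siblings to_root x); last by rewrite oppr0.
    have xsy : x \in parent_clique y.
      by rewrite in_setU1 (siblings_eq bg xr ys) siblings_refl orbT.
    by rewrite (negPf (parent_cliqueNdesc bg yr xsy xy)) in dx.
  - by have [_ /eqP] := desc_boundary bg to_root xv dx dv; rewrite (negPf xy).
  - rewrite adj_sym in xv; have [_ vy xKy] := desc_boundary bg to_root xv dv dx.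
    rewrite vy in vx vK *; rewrite eqxx sub0r.
    have -> // : y \in siblings to_root x.
    move: vK; rewrite in_setU1 => /predU1P[ey|//].
    have dx' := dist_parent to_root xr; have dy := dist_parent to_root yr.
    move: xKy; rewrite in_setU1 => /predU1P[ex|/(siblings_parent bg yr)[_ _]].
      by rewrite -ex in dy; rewrite -ey in dx'; lia.
    by rewrite -ey in dx'; lia.
  - rewrite subrr; have [vy|] := eqVneq v y; last by rewrite oppr0.
    by rewrite vy (desc_self to_root) in dv.
rewrite (eq_bigr _ other) sumrN; congr (- _).
have [ys|yNs] := boolP (y \in siblings to_root x); last first.
  by rewrite big1 // => v _; rewrite andbF.
rewrite (bigD1 y) /=; last by rewrite in_setD1 eq_sym xy in_setU1 ys orbT.
by rewrite eqxx big1 ?addr0 // => v /andP[_ /negPf->].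
Qed.

End Entries.

(** * Matching vertices with block-diagonal indices *)
Lemma card_sig1 k (p : 'I_k -> nat) (i : 'I_k) :
  #|[set q : 'I_(\sum_i p i) | tagnat.sig1 q == i]| = p i.
Proof.
have injR : injective (@tagnat.Rank _ p i).
  by move=> a b /eqP; rewrite -val_eqE /= tagnat.eq_Rank eqxx => /eqP/val_inj.
rewrite -[RHS]card_ord -cardsT -(card_imset _ injR); apply: eq_card => q.
rewrite inE; apply/eqP/imsetP => [<-|[j _ ->]]; last exact: tagnat.Rank1K.
by exists (tagnat.sig2 q); rewrite ?tagnat.sig2K.
Qed.

(** Both maps list the same multiset of values in nondecreasing order. *)
Lemma monotone_sig1 k (p : 'I_k -> nat) (f : 'I_(\sum_i p i) -> 'I_k) :
  {homo f : a b / (a <= b)%N >-> (a <= b)%N} ->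
  (forall i, #|[set q | f q == i]| = p i) -> f =1 tagnat.sig1.
Proof.
move=> fmono fcard q.
have leT_tr : transitive (fun a b : 'I_k => (a <= b)%N).
  by move=> ? ? ?; apply: leq_trans.
have leT_asym : antisymmetric (fun a b : 'I_k => (a <= b)%N).
  by move=> a b /anti_leq/val_inj.
have sorted_im (g : 'I_(\sum_i p i) -> 'I_k) :
    {homo g : a b / (a <= b)%N >-> (a <= b)%N} ->
    sorted (fun a b : 'I_k => (a <= b)%N) (map g (enum 'I_(\sum_i p i))).
  move=> gmono; apply: (homo_sorted gmono).
  by have := iota_sorted 0 (\sum_i p i); rewrite -val_enum_ord sorted_map.
have countE (g : 'I_(\sum_i p i) -> 'I_k) i :
    count_mem i (map g (enum 'I_(\sum_i p i))) = #|[set q | g q == i]|.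
  rewrite count_map -size_filter cardE /enum_mem -enumT filter_predT.
  by congr size; apply: eq_filter => a; rewrite /= inE.
have /eq_in_map : map f (enum 'I_(\sum_i p i)) = map tagnat.sig1 (enum 'I_(\sum_i p i)).
  apply: (sorted_eq leT_tr leT_asym); try apply: sorted_im => //.
    by move=> a b; apply: tagnat.le_sig1.
  by apply/allP => i _ /=; rewrite !countE fcard card_sig1.
by apply; rewrite mem_enum.
Qed.

(** For [s = 2] both branches of [Bmx] give the same matrix, as [2 - 1 = 1]. *)
Lemma BmxE (R : comNzRingType) s (i j : 'I_s.-1) :
  Bmx R s i j = s%:R *+ (i == j) - 1.
Proof.
rewrite /Bmx; case: ifP => [/eqP s2|_]; last by rewrite !mxE.
move: i j; rewrite s2 => i j.
by rewrite !ord1 mxE eqxx mulr1n mulr2n addrK.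
Qed.

Lemma mxdiag_BmxE (R : comNzRingType) k (s : 'I_k -> nat)
    (a b : 'I_(\sum_i (s i).-1)) :
  (\mxdiag_i Bmx R (s i)) a b =
  (s (tagnat.sig1 a))%:R *+ (a == b) - (tagnat.sig1 a == tagnat.sig1 b)%:R.
Proof.
rewrite /mxdiag mxE; case: ifP => [/eqP e|ne]; last first.
  rewrite mxE subr0; have [eab|//] := eqVneq a b.
  by rewrite eab eqxx in ne.
rewrite -(can_eq (@tagnat.sigK _ _)) !tagnat.sigE12.
case: _ / e (tagnat.sig2 b) => j; rewrite conform_mx_id BmxE.
by rewrite eq_Tagged.
Qed.

Theorem theorem16 (R : comNzRingType) (m : nat) (G : sgraph 'I_m.+1)
    (hV : verts G = [set: 'I_m.+1])
    (hconn : connected G)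
    (hblock : block_graph G)
    (hroot : ~~ cut_vertex G ord_max)
    (hrootK : exists K : {set 'I_m.+1},
        [/\ maximal_clique G K, ord_max \in K &
            #|[set x in K | cut_vertex G x]| = 1%N])
    (hconsec : forall (H : sgraph 'I_m.+1) (x y z : 'I_m.+1),
        block G H -> (x <= y <= z)%N ->
        assigned G ord_max H x -> assigned G ord_max H z ->
        assigned G ord_max H y)
    (k : nat) (B : 'I_k -> sgraph 'I_m.+1)
    (hB : forall i, block G (B i))
    (hBall : forall H, block G H -> exists! i, same_graph H (B i))
    (hBorder : forall (i j : 'I_k) (x y : 'I_m.+1), (i < j)%N ->
        assigned G ord_max (B i) x -> assigned G ord_max (B j) y -> (x < y)%N) :
  exists E : (\sum_(i < k) (#|verts (B i)|).-1 + 1)%N = m.+1,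
    path_matrix R G ord_max *m laplacian R G *m (path_matrix R G ord_max)^T
    = castmx (E, E)
        (block_mx (\mxdiag_(i < k) Bmx R #|verts (B i)|) 0 0 (0 : 'M[R]_1)).
Proof.
have to_root x : connect (adj G) x ord_max by apply: hconn.2; rewrite hV inE.
pose K := parent_clique to_root.
have blkP x : x != ord_max -> exists! i, verts (B i) = K x.
  move=> xr; have [H bH VH] := parent_clique_block hblock hV to_root xr.
  have [i [[Vi _] iuniq]] := hBall H bH.
  exists i; split=> [|j Vj]; first by rewrite -Vi.
  by apply/iuniq/(block_same_graph hblock bH (hB j)); rewrite VH.
(* Double counting of the pairs of a vertex other than the root and the block
   that it is assigned to. *)
have sumE : (\sum_(i < k) (#|verts (B i)|).-1)%N = m.
  under eq_bigr => i _ do rewrite -(card_parent_clique_fibre hblock hV to_root (hB i))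
    cardsE -sum1_card big_mkcondr.
  rewrite exchange_big /= (eq_bigr (fun=> 1%N)) => [|y yr].
    by rewrite sum1_card cardC1 card_ord.
  have [i [Vi iuniq]] := blkP y yr.
  rewrite (bigD1 i) //= Vi eqxx big1 // => j /negPf ji.
  by case: eqP => // /iuniq ij; rewrite ij eqxx in ji.
have E : (\sum_(i < k) (#|verts (B i)|).-1 + 1)%N = m.+1 by rewrite sumE addn1.
exists E.
pose x (q : 'I_(\sum_(i < k) (#|verts (B i)|).-1)) := cast_ord E (lshift 1 q).
have xr q : x q != ord_max by rewrite -val_eqE ltn_eqF //= -[ltnRHS]sumE.
have x_inj : injective x by move=> a b /cast_ord_inj/lshift_inj.
have x_surj y : y != ord_max -> exists q, y = x q.
  move=> yr; have ym : (y < \sum_(i < k) (#|verts (B i)|).-1)%N.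
    by rewrite sumE ltn_neqAle -ltnS ltn_ord andbT.
  by exists (Ordinal ym); apply: val_inj.
have xmax (j : 'I_1) : cast_ord E (rshift _ j) = ord_max :> 'I_m.+1.
  by apply: val_inj; rewrite ord1 /= addn0 sumE.
have /boolp.choice[f fP] : forall q, exists i, verts (B i) = K (x q).
  by move=> q; have [i [Vi _]] := blkP _ (xr q); exists i.
have fE q i : (verts (B i) == K (x q)) = (f q == i).
  apply/eqP/eqP => [Vi|<-]; last exact: fP.
  by have [j [_ juniq]] := blkP _ (xr q); rewrite -(juniq _ (fP q)) (juniq _ Vi).
have fsig : f =1 tagnat.sig1.
  apply: monotone_sig1 => [a b ab|i].
    rewrite leqNgt; apply/negP => fba.
    have asg q : assigned G ord_max (B (f q)) (x q).
      by apply: (assigned_parent_clique hblock (to_root := to_root)) => //; apply: fP.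
    by have := hBorder _ _ _ _ fba (asg b) (asg a); rewrite /= ltnNge ab.
  rewrite -(card_parent_clique_fibre hblock hV to_root (hB i)) -(card_imset _ x_inj).
  apply: eq_card => y; rewrite [RHS]inE; apply/imsetP/andP => [[q + ->]|[yr Vi]].
    by rewrite inE -fE; split.
  have [q ey] := x_surj y yr; exists q => //.
  by rewrite inE -fE -ey.
apply/matrixP => a b; rewrite castmxE /=.
rewrite -[in LHS](cast_ordKV E a) -[in LHS](cast_ordKV E b).
case: (split_ordP (cast_ord (esym E) a)) => [p ->|j ->]; last first.
  rewrite [in LHS]xmax path_laplacian_rootl //.
  case: (split_ordP (cast_ord (esym E) b)) => ? ->;
    by rewrite ?block_mxEdl ?block_mxEdr mxE.
case: (split_ordP (cast_ord (esym E) b)) => [q ->|j ->]; last first.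
  by rewrite [in LHS]xmax path_laplacian_rootr // block_mxEur mxE.
rewrite -!/(x _) block_mxEul mxdiag_BmxE path_laplacian_entry // -/K.
by rewrite -!fsig -fE !fP (inj_eq x_inj).
Qed.
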